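(* Let $(A,\leq,{}',0,1)$ be a finite orthomodular poset, $(T,R)$ a time frame and $P,F,H,G$ the tense operators constructed by $(T,R)$. Let $R^*$ be the binary relation on $T$ defined by: $s\mathrel{R^*}t$ if and only if for each $q\in A^T$ both $G(q)(s)\leq q(t)\leq F(q)(s)$ and $H(q)(t)\leq q(s)\leq P(q)(t)$. Then $R\subseteq R^*$. Moreover, let $X\in\{P,F,H,G\}$, $q\in A^T$ and $s\in T$, let $X^*$ denote the tense operator constructed by $(T,R^* )$ corresponding to $X$, and put $i:=1$ if $X\in\{H,G\}$ and $i:=2$ otherwise. Then $X(q)(s)\approx_iX^*(q)(s)$.
   Context: An orthomodular poset is a bounded poset $(A,\leq,0,1)$ with a unary operation ${}'$ that is an antitone involution and a complementation ($a\vee a'=1$, $a\wedge a'=0$), such that if $x\leq y'$ then $x\vee y$ exists, and if $x\leq y$ then $y=x\vee(y\wedge x')$. For $B\subseteq A$: $L(B)$, $U(B)$ are the sets of lower and upper bounds of $B$ in $A$; $\operatorname{Max}B$, $\operatorname{Min}B$ are the sets of maximal and minimal elements. A time frame is $(T,R)$ with $T\neq\emptyset$, $R\subseteq T^2$ serial (each $s$ has some $r\mathrel Rs$ and some $s\mathrel Rt$). The tense operators constructed by a time frame $(T,S)$ are the maps $A^T\to(2^A\setminus\{\emptyset\})^T$: $P(q)(s)=\operatorname{Min}U(\{q(t)\mid t\mathrel Ss\})$, $F(q)(s)=\operatorname{Min}U(\{q(t)\mid s\mathrel St\})$, $H(q)(s)=\operatorname{Max}L(\{q(t)\mid t\mathrel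 Ss\})$, $G(q)(s)=\operatorname{Max}L(\{q(t)\mid s\mathrel St\})$. For a nonempty $B\subseteq A$ and $a\in A$, $B\leq a$ means $b\leq a$ for all $b\in B$, and $a\leq B$ means $a\leq b$ for all $b\in B$. For nonempty $B,C\subseteq A$: $B\leq_1C$ iff $\forall b\in B\,\exists c\in C: b\leq c$; $B\leq_2C$ iff $\forall c\in C\,\exists b\in B: b\leq c$; $B\approx_iC$ iff $B\leq_iC$ and $C\leq_iB$. *)

(* Defs.v *)
From HB Require Import structures.
From mathcomp Require Import all_boot all_order.
From mathcomp Require Import boolp classical_sets.

Set Implicit Arguments.
Unset Strict Implicit.
Unset Printing Implicit Defensive.
Import Order.TTheory.

Local Open Scope order_scope.
Local Open Scope classical_set_scope.

(* Joins and meets need not exist in a poset: [supremums [set x; y] z] reads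
   "x ∨ y exists and equals z", and dually for [infimums]. *)
Record orthomodular d (A : tbPOrderType d) (compl : A -> A) : Prop := {
  compl_antitone : forall x y, x <= y -> compl y <= compl x;
  compl_involutive : forall x, compl (compl x) = x;
  join_compl : forall x, supremums [set x; compl x] \top;
  meet_compl : forall x, infimums [set x; compl x] \bot;
  join_exists : forall x y, x <= compl y -> supremums [set x; y] !=set0;
  orthomodular_law : forall x y, x <= y ->
    exists2 m, infimums [set y; compl x] m & supremums [set x; m] y
}.

Definition serial T (R : T -> T -> Prop) : Prop :=
  forall s, (exists r, R r s) /\ (exists t, R s t).

Definition time_frame T (R : T -> T -> Prop) : Prop := inhabited T /\ serial R.

Section TenseOperators.
Context d (A : porderType d) (T : Type).
Implicit Types (B C : set A) (a b : A) (S : T -> T -> Prop) (q : T -> A).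

Definition Max B : set A := [set b | B b /\ forall c, B c -> b <= c -> c = b].
Definition Min B : set A := [set b | B b /\ forall c, B c -> c <= b -> c = b].

(* The values are nonempty when A is finite and bounded: see
   [tense_P_nonempty] and the three lemmas after it. *)
Definition tense_P S q (s : T) : set A := Min (ubound [set q t | t in S^~ s]).
Definition tense_F S q (s : T) : set A := Min (ubound [set q t | t in S s]).
Definition tense_H S q (s : T) : set A := Max (lbound [set q t | t in S^~ s]).
Definition tense_G S q (s : T) : set A := Max (lbound [set q t | t in S s]).

Definition set_le_elt B a : Prop := forall b, B b -> b <= a.
Definition elt_le_set a B : Prop := forall b, B b -> a <= b.

Definition le1 B C : Prop := forall b, B b -> exists2 c, C c & b <= c.
Definition le2 B C : Prop := forall c, C c -> exists2 b, B b & b <= c.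
Definition approx1 B C : Prop := le1 B C /\ le1 C B.
Definition approx2 B C : Prop := le2 B C /\ le2 C B.

Definition rel_star S (s t : T) : Prop := forall q : T -> A,
  (set_le_elt (tense_G S q s) (q t) /\ elt_le_set (q t) (tense_F S q s)) /\
  (set_le_elt (tense_H S q t) (q s) /\ elt_le_set (q s) (tense_P S q t)).

End TenseOperators.

Lemma Max_nonempty d (A : finPOrderType d) (B : set A) :
  B !=set0 -> Max B !=set0.
Proof.
case=> x; have [n] := ubnP #|[pred y | x < y]|.
elim: n x => // n IHn x ltn Bx.
have [[y By xy]|nex] := pselect (exists2 y, B y & x < y).
  apply: (IHn y) => //; rewrite -ltnS; apply: leq_trans ltn.
  rewrite ltnS; apply: proper_card; apply/properP; split.
    by apply/fintype.subsetP => z; rewrite !inE; apply: lt_trans.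
  by exists y; rewrite !inE ?ltxx.
exists x; split=> // c Bc; rewrite le_eqVlt => /orP[/eqP //|xc].
by case: nex; exists c.
Qed.

Lemma Min_nonempty d (A : finPOrderType d) (B : set A) :
  B !=set0 -> Min B !=set0.
Proof. by move=> B0; have := @Max_nonempty _ A^d B B0. Qed.

Section Nonempty.
Context d (A : finTBPOrderType d) (T : Type).
Context (S : T -> T -> Prop) (q : T -> A) (s : T).

Lemma tense_P_nonempty : tense_P S q s !=set0.
Proof. by apply: Min_nonempty; exists \top => x _; apply: lex1. Qed.

Lemma tense_F_nonempty : tense_F S q s !=set0.
Proof. by apply: Min_nonempty; exists \top => x _; apply: lex1. Qed.

Lemma tense_H_nonempty : tense_H S q s !=set0.
Proof. by apply: Max_nonempty; exists \bot => x _; apply: le0x. Qed.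

Lemma tense_G_nonempty : tense_G S q s !=set0.
Proof. by apply: Max_nonempty; exists \bot => x _; apply: le0x. Qed.

End Nonempty.

(* Main.v *)
(** Enlarging the relation from [R] to [R*] shrinks the set of lower bounds,
    but by the definition of [R*] every maximal lower bound for [R] is still a
    lower bound for [R*].  Finiteness puts a maximal element above each element
    of these sets, so their sets of maximal elements are equivalent; upper
    bounds are dual. *)
Require Import Defs.
From mathcomp Require Import all_boot all_order.
From mathcomp Require Import boolp classical_sets.

(** A maximal element of the part of [B] above [x] is maximal in all of [B], as anything in [B]
    above it is again above [x]. *)
Lemma Max_above d (A : finPOrderType d) (B : set A) (x : A) :
  B x -> exists2 m, Max B m & (x <= m)%O.
Proof.
move=> Bx; have [] := @Max_nonempty _ A [set y | B y /\ (x <= y)%O].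
  by exists x; split.
move=> m [[Bm xm] maxm]; exists m => //; split=> // c Bc mc.
by apply: maxm => //; split=> //; apply: Order.POrderTheory.le_trans mc.
Qed.

Lemma approx1_Max d (A : finPOrderType d) (B C : set A) :
  (C `<=` B)%classic -> (Max B `<=` C)%classic ->
  approx1 (Max B) (Max C).
Proof.
move=> CB MBC; split=> b; first by move=> /MBC /Max_above.
by move=> [/CB /Max_above].
Qed.

Lemma approx2_Min d (A : finPOrderType d) (B C : set A) :
  (C `<=` B)%classic -> (Min B `<=` C)%classic ->
  approx2 (Min B) (Min C).
(* In the dual order [le1 B C] reads [le2 C B], so the two halves are exchanged. *)
Proof. by move=> CB MBC; have [] := @approx1_Max _ A^d%O B C CB MBC. Qed.

(** When [R s t], [q t] is among the values bounded by [G] and [F] at [s], and [q s] among those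
    bounded by [H] and [P] at [t]. *)
Lemma sub_rel_star d (A : porderType d) (T : Type) (R : T -> T -> Prop) s t :
  R s t -> @rel_star d A T R s t.
Proof.
move=> Rst q; split; split=> b [bB _]; apply: bB.
- by exists t.
- by exists t.
- by exists s.
- by exists s.
Qed.

Theorem theorem17 (d : Order.disp_t) (A : finTBPOrderType d) (compl : A -> A)
    (hA : orthomodular compl)
    (T : Type) (R : T -> T -> Prop) (hR : time_frame R) :
  let Rs := @rel_star d A T R in
  (forall s t : T, R s t -> Rs s t) /\
  (forall (q : T -> A) (s : T),
    [/\ approx2 (tense_P R q s) (tense_P Rs q s),
        approx2 (tense_F R q s) (tense_F Rs q s),
        approx1 (tense_H R q s) (tense_H Rs q s)
      & approx1 (tense_G R q s) (tense_G Rs q s)]).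
Proof.
move=> Rs; split=> [s t|q s]; first exact: sub_rel_star.
split; [apply: approx2_Min|apply: approx2_Min
       |apply: approx1_Max|apply: approx1_Max].
- by move=> b bB _ [t Rts <-]; apply: bB; exists t => //; apply: sub_rel_star.
(* The definition of [Rs t s], taken at [q] itself, puts [q t] below every element of
   [tense_P R q s]. *)
- by move=> b bP _ [t /(_ q)[_ [_ qP]] <-]; apply: qP.
- by move=> b bB _ [t Rst <-]; apply: bB; exists t => //; apply: sub_rel_star.
- by move=> b bF _ [t /(_ q)[[_ qF] _] <-]; apply: qF.
- by move=> b bB _ [t Rts <-]; apply: bB; exists t => //; apply: sub_rel_star.
- by move=> b bH _ [t /(_ q)[_ [qH _]] <-]; apply: qH.
- by move=> b bB _ [t Rst <-]; apply: bB; exists t => //; apply: sub_rel_star.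
- by move=> b bG _ [t /(_ q)[[qG _] _] <-]; apply: qG.
Qed.
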